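(* Let $p$ and $q$ be primes and let $R$ be a ring with unity such that $|R|=p^3q$ and $|Z(R)|=p^2$. (a) If $(p-1)\mid(pq-1)$, then $$\sigma_{\mathrm{snm}}(\Gamma_R)=\Big\{[-(p^3-p^2-1)^2]^{\frac{(pq-1)(p^3-p^2-1)}{p-1}},\ [(p^3-p^2-1)^3]^{\frac{pq-1}{p-1}}\Big\}$$ and $E_{\mathrm{sn}}(\Gamma_R)=\frac{2(pq-1)(p^3-p^2-1)^3}{p-1}$. (b) If $(q-1)\mid(pq-1)$, then $$\sigma_{\mathrm{snm}}(\Gamma_R)=\Big\{[-(p^2q-p^2-1)^2]^{\frac{(pq-1)(p^2q-p^2-1)}{q-1}},\ [(p^2q-p^2-1)^3]^{\frac{pq-1}{q-1}}\Big\}$$ and $E_{\mathrm{sn}}(\Gamma_R)=\frac{2(pq-1)(p^2q-p^2-1)^3}{q-1}$. (c) If $l_1,l_2$ are non-negative integers with $pq-1=(p-1)l_1+(q-1)l_2$, then $$\sigma_{\mathrm{snm}}(\Gamma_R)=\Big\{[-(p^3-p^2-1)^2]^{l_1(p^3-p^2-1)},\ [(p^3-p^2-1)^3]^{l_1},\ [-(p^2q-p^2-1)^2]^{l_2(p^2q-p^2-1)},\ [(p^2q-p^2-1)^3]^{l_2}\Big\}$$ and $E_{\mathrm{sn}}(\Gamma_R)=2l_1(p^3-p^2-1)^3+2l_2(p^2q-p^2-1)^3$.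
   Context: For a ring $R$, $Z(R)$ is its center. For a finite non-commutative ring $R$, the commuting graph $\Gamma_R$ is the simple graph with vertex set $R\setminus Z(R)$ in which two distinct vertices are adjacent if they commute. Let $\Gamma$ be a finite simple graph with vertices $v_1,\dots,v_n$. Let $N(v_i)$ be the set of vertices adjacent to $v_i$, let $N^2(v_i)=\big(\bigcup_{u\in N(v_i)}N(u)\big)\setminus\{v_i\}$, and let $\delta_2(v_i)=\sum_{x\in N^2(v_i)}\deg x$. The minimum second neighborhood degree matrix $\mathrm{snm}(\Gamma)$ is the $n\times n$ matrix whose $(i,j)$ entry is $\min\{\delta_2(v_i),\delta_2(v_j)\}$ if $i\neq j$ and $v_i,v_j$ are adjacent, and $0$ otherwise. The MSN-spectrum $\sigma_{\mathrm{snm}}(\Gamma)$ is the multiset of eigenvalues of $\mathrm{snm}(\Gamma)$; $\{[\sigma_1]^{\alpha_1},\dots,[\sigma_k]^{\alpha_k}\}$ means eigenvalue $\sigma_i$ with multiplicity $\alpha_i$ (multiplicities of repeated values are added, entries with multiplicity $0$ are omitted). The MSN-energy is $E_{\mathrm{sn}}(\Gamma)=$ the sum of the absolute values of the eigenvalues of $\mathrm{snm}(\Gamma)$, counted with multiplicity. *)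

(* Defs.v *)
From HB Require Import structures.
From mathcomp Require Import all_boot all_order all_algebra.
From mathcomp Require Import finmap multiset.

Set Implicit Arguments.
Unset Strict Implicit.
Unset Printing Implicit Defensive.

Import Order.TTheory GRing.Theory Num.Theory.
Local Open Scope ring_scope.
Local Open Scope mset_scope.

Record sgraph := SGraph {
  vertex :> finType;
  adj : rel vertex;
  adj_sym : symmetric adj;
  adj_irrefl : irreflexive adj }.

Section SecondNeighborhood.
Variable G : sgraph.
Implicit Types u v : G.

Definition nbr v : {set G} := [set u | adj v u].

Definition deg v : nat := #|nbr v|.

Definition nbr2 v : {set G} := (\bigcup_(u in nbr v) nbr u)%SET :\ v.

Definition delta2 v : nat := (\sum_(x in nbr2 v) deg x)%N.

(* The vertices are numbered by [enum_val : 'I_#|G| -> G]. *)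
Definition snm (K : nzRingType) : 'M[K]_#|G| :=
  \matrix_(i, j)
    if (i != j) && adj (enum_val i) (enum_val j)
    then (minn (delta2 (enum_val i)) (delta2 (enum_val j)))%:R
    else 0.

End SecondNeighborhood.

(* Eigenvalues counted with algebraic multiplicity: the roots of the (monic)
   characteristic polynomial, which splits since C is algebraically closed.
   Only the order of the chosen list of roots is arbitrary. *)
Definition eigenvalues (C : numClosedFieldType) n (A : 'M[C]_n) : {mset C} :=
  seq_mset (sval (closed_field_poly_normal (char_poly A))).

Lemma eigenvaluesP (C : numClosedFieldType) n (A : 'M[C]_n) :
  char_poly A = \prod_(x <- eigenvalues A) ('X - x%:P).
Proof.
rewrite /eigenvalues; case: closed_field_poly_normal => s /= {1}->.
rewrite (monicP (char_poly_monic A)) scale1r.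
by apply: perm_big; rewrite perm_sym perm_eq_seq_mset.
Qed.

Definition MSN_spectrum (C : numClosedFieldType) (G : sgraph) : {mset C} :=
  eigenvalues (snm G C).

Definition MSN_energy (C : numClosedFieldType) (G : sgraph) : C :=
  \sum_(x <- MSN_spectrum C G) `|x|.

Definition ring_center (R : finPzRingType) : {set R} :=
  [set z | [forall x, z * x == x * z]].

Section CommutingGraph.
Variable R : finPzRingType.

Definition noncentral := {x : R | x \notin ring_center R}.

Definition commuting_adj : rel noncentral :=
  fun x y => (x != y) && (val x * val y == val y * val x).

Lemma commuting_adj_sym : symmetric commuting_adj.
Proof. by move=> x y; rewrite /commuting_adj eq_sym [X in _ && X]eq_sym. Qed.

Lemma commuting_adj_irrefl : irreflexive commuting_adj.
Proof. by move=> x; rewrite /commuting_adj eqxx. Qed.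

Definition commuting_graph : sgraph :=
  SGraph commuting_adj_sym commuting_adj_irrefl.

End CommutingGraph.

(* Main.v *)
Require Import Defs.
From HB Require Import structures.
From mathcomp Require Import all_boot all_order all_algebra.
From mathcomp Require Import all_fingroup all_solvable.
From mathcomp Require Import finmap multiset.
From mathcomp Require Import ring zify.

(* The additive group [R / Z(R)] has order [p * q]. If [p] and [q] were
   distinct it would be cyclic and [R] commutative, so [p = q]. Then every
   proper centralizer has order [p ^ 3], hence is cyclic modulo [Z(R)] and
   commutative. So the commuting graph is a disjoint union of [p + 1] cliques of
   size [p ^ 3 - p ^ 2], and all three parts describe the same spectrum. For
   cliques of degree [d], [snm] satisfies a quadratic equation with roots [d ^ 3]
   and [- d ^ 2]; it has trace 0, which determines the multiplicities. *)

Import Order.TTheory GRing.Theory Num.Theory.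

Local Open Scope ring_scope.
Local Open Scope mset_scope.

(** * Eigenvalue multisets: size, sum, and quadratic relations *)

Section Spectrum.
Variables (C : numClosedFieldType) (n : nat) (A : 'M[C]_n).

Lemma size_eigenvalues : size (eigenvalues A) = n.
Proof.
by have := size_char_poly A; rewrite eigenvaluesP size_prod_XsubC => -[].
Qed.

Lemma sum_eigenvalues : \sum_(x <- eigenvalues A) x = \tr A.
Proof.
(* The trace is a coefficient of the characteristic polynomial only for positive size; the empty
   matrix is treated apart. *)
have [n0 | n_gt0] := posnP n.
  have /size0nil -> : size (eigenvalues A) = 0%N by rewrite size_eigenvalues.
  by rewrite big_nil /mxtrace big1 // => i; have := ltn_ord i; rewrite [X in (_ < X)%N]n0.
apply: oppr_inj; rewrite -char_poly_trace // eigenvaluesP.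
have := @coefPn_prod_XsubC C (eigenvalues A).
by rewrite size_eigenvalues -lt0n => ->.
Qed.

(** Evaluating the matrix identity on an eigenvector for [x] turns it into a scalar identity. *)
Lemma eigenvalues_quadratic (b c : C) :
  A *m A = b *: A + c%:M ->
  {in eigenvalues A, forall x, x ^+ 2 = b * x + c}.
Proof.
move=> AA x xA; have : root (char_poly A) x by rewrite eigenvaluesP root_prod_XsubC.
rewrite -eigenvalue_root_char => /eigenvalueP[v vA v0].
have : v *m A *m A = (x ^+ 2) *: v by rewrite vA -scalemxAl vA scalerA.
rewrite -mulmxA AA mulmxDr -scalemxAr vA mul_mx_scalar scalerA -scalerDl.
by move=> /esym/eqP; rewrite -subr_eq0 -scalerBl scaler_eq0 (negPf v0) orbF subr_eq0 => /eqP.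
Qed.

End Spectrum.

Lemma sum_msetn2 (K : choiceType) (V : nmodType) (m1 m2 : nat) (x y : K) (f : K -> V) :
  \sum_(z <- msetn m1 x `+` msetn m2 y) f z = f x *+ m1 + f y *+ m2.
Proof.
have mE : perm_eq (msetn m1 x `+` msetn m2 y) (nseq m1 x ++ nseq m2 y).
  by apply/allP=> z _; rewrite /= count_mem_mset msetE2 count_cat !msetnE !count_nseq /= ![_ == z]eq_sym;
    do 2 case: (z == _); rewrite ?mul1n ?mul0n.
rewrite (perm_big _ mE).
by rewrite big_cat !big_nseq !iter_addr_0.
Qed.

Lemma mset_two_values (K : choiceType) (X : {mset K}) (x y : K) :
  x != y -> {in X, forall z, (z == x) || (z == y)} -> X = msetn (X x) x `+` msetn (X y) y.
Proof.
move=> xy Xxy; apply/msetP=> z; rewrite msetE2 !msetnE.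
have [-> | zx] := eqVneq z x; first by rewrite (negPf xy) addn0.
have [-> | zy] := eqVneq z y; first by rewrite add0n.
apply/mset_eq0P/negP => /Xxy; by rewrite (negPf zx) (negPf zy).
Qed.

(** * The matrix [snm] of a disjoint union of cliques of degree [d] *)

Section DisjointCliques.
Variables (G : sgraph) (d : nat).
Hypotheses (d_gt1 : (1 < d)%N) (regG : forall v : G, deg v = d).
Hypothesis transG : forall u v w : G, adj u v -> adj v w -> u != w -> adj u w.
Arguments transG {u} v {w}.

(** Two steps never leave a clique; conversely, as [1 < d], a neighbor is also reached through a
    third vertex of the clique. *)
Lemma nbr2_cliques (v : G) : nbr2 v = nbr v.
Proof.
apply/setP=> w; rewrite !inE; apply/andP/idP=> [[wv /bigcupP[u]]|vw].
  by rewrite !inE => vu uw; rewrite (transG u) // eq_sym.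
split; first by apply: contraTneq vw => ->; rewrite adj_irrefl.
have /card_gt0P[u] : (0 < #|nbr v :\ w|)%N.
  by have := cardsD1 w (nbr v); rewrite -/(deg v) regG inE vw; lia.
rewrite !inE => /andP[uw vu]; apply/bigcupP; exists u; rewrite !inE //.
by rewrite (transG v) // adj_sym.
Qed.

Lemma delta2_cliques (v : G) : delta2 v = (d ^ 2)%N.
Proof.
rewrite /delta2 nbr2_cliques (eq_bigr (fun=> d)) => [|u _]; last exact: regG.
by rewrite sum_nat_const -/(deg v) regG.
Qed.

Lemma snm_cliques (K : nzRingType) (i j : 'I_#|G|) :
  snm G K i j = (d ^ 2 * adj (enum_val i) (enum_val j))%:R.
Proof.
rewrite mxE !delta2_cliques minnn.
have [-> | _] := eqVneq i j; first by rewrite adj_irrefl muln0.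
by case: adj; rewrite ?muln1 ?muln0.
Qed.

(** These are the entries of the squared adjacency matrix. Adjacent vertices share the rest of their
    clique, and distinct cliques share nothing. *)
Lemma card_common_nbr (u w : G) :
  #|[set v | adj u v && adj v w]| = ((d - 1) * adj u w + d * (u == w))%N.
Proof.
have [<- | uw] := eqVneq u w.
  rewrite adj_irrefl muln0 add0n muln1 -(regG u); apply: eq_card => v.
  by rewrite !inE [adj v u]adj_sym andbb.
rewrite muln0 addn0; have [uw1 | nuw] := boolP (adj u w).
  have -> : [set v | adj u v && adj v w] = nbr u :\ w.
    apply/setP=> v; rewrite !inE andbC; have [uv|] := boolP (adj u v); last by rewrite !andbF.
    rewrite !andbT; apply/idP/idP => [|vw]; first by apply: contraTneq => ->; rewrite adj_irrefl.
    by rewrite (transG u) // adj_sym.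
  by have := cardsD1 w (nbr u); rewrite -/(deg u) regG inE uw1; lia.
rewrite muln0; apply: eq_card0 => v; rewrite !inE; apply: contraNF nuw.
by case/andP=> uv vw; apply: (transG v).
Qed.

(** With [B] the adjacency matrix, [snm] is [d ^ 2 * B] and [B ^ 2 = (d - 1) * B + d]; scale the
    latter by [d ^ 4]. *)
Lemma snm_cliques_sqr (K : comNzRingType) :
  snm G K *m snm G K = (d ^ 2 * (d - 1))%:R *: snm G K + ((d ^ 5)%:R)%:M.
Proof.
apply/matrixP=> i j; rewrite 3!mxE snm_cliques [in RHS]mxE.
transitivity ((\sum_(v : G) d ^ 4 * (adj (enum_val i) v && adj v (enum_val j)))%:R : K).
  rewrite natr_sum [RHS]big_enum_val; apply: eq_bigr => k _.
  by rewrite !snm_cliques -natrM mulnACA -expnD mulnb.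
rewrite -[_ *+ (i == j)]mulr_natr -!natrM -natrD -big_distrr /=; congr _%:R.
have -> : (\sum_v (adj (enum_val i) v && adj v (enum_val j)) =
   #|[set v | adj (enum_val i) v && adj v (enum_val j)]|)%N.
  rewrite -sum1_card [RHS]big_mkcond /=; apply: eq_bigr => v _.
  by rewrite inE; case: (_ && _).
(* The truncated difference [d - 1] is made a variable, because [ring] cannot interpret it in
   [nat]. *)
rewrite card_common_nbr (inj_eq enum_val_inj); move: (d - 1)%N => e; ring.
Qed.

Lemma mxtrace_snm (K : nzRingType) : \tr (snm G K) = 0.
Proof. by rewrite /mxtrace big1 // => i _; rewrite mxE eqxx. Qed.

(* The trace vanishes, so the multiplicities of the two roots [d ^ 3] and
   [- d ^ 2] of the quadratic equation satisfied by [snm G C] are in the ratio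
   [1 : d]. *)
Lemma MSN_spectrum_cliques (C : numClosedFieldType) (k : nat) :
  #|G| = (k * d.+1)%N ->
  MSN_spectrum C G = msetn (k * d)%N (- d%:R ^+ 2) `+` msetn k (d%:R ^+ 3).
Proof.
move=> cardG; have d0 : d%:R != 0 :> C by rewrite pnatr_eq0; lia.
have neq : - d%:R ^+ 2 != d%:R ^+ 3 :> C.
  rewrite eq_sym -addr_eq0 -[_ + _]/(_ ^+ 3 + _ ^+ 2) -!natrX -natrD pnatr_eq0.
  by rewrite -lt0n addn_gt0 expn_gt0; lia.
have Xxy : {in MSN_spectrum C G, forall z, (z == - d%:R ^+ 2) || (z == d%:R ^+ 3)}.
  move=> z /(eigenvalues_quadratic _ _ _ _ _ (snm_cliques_sqr C)) zE.
  rewrite -subr_eq0 -[z == d%:R ^+ 3]subr_eq0 -mulf_eq0.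
  have -> : (z - - d%:R ^+ 2) * (z - d%:R ^+ 3) = z ^+ 2 - (d%:R ^+ 3 - d%:R ^+ 2) * z - d%:R ^+ 5 by ring.
  rewrite zE natrM natrB ?natrX; last lia.
  apply/eqP; ring.
have sE := mset_two_values _ _ _ _ neq Xxy.
(* The multiplicities mention the spectrum itself, so they are generalized before rewriting with
   [sE]. *)
move: sE; move: (MSN_spectrum C G (- _)) (MSN_spectrum C G (_ ^+ 3)) => m1 m2 sE.
have : (m1 + m2)%N = #|G|.
  rewrite -(size_eigenvalues _ _ (snm G C)) -sum1_size -/(MSN_spectrum C G) sE sum_msetn2.
  by rewrite !natn.
have := mxtrace_snm C. rewrite -sum_eigenvalues -/(MSN_spectrum C G) sE sum_msetn2.
(* Trace 0 thus gives [m1 = d * m2], and [m1 + m2 = k * d.+1] then forces [m2 = k]. *)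
have -> : - d%:R ^+ 2 *+ m1 + d%:R ^+ 3 *+ m2 = d%:R ^+ 2 * ((d * m2)%:R - m1%:R) :> C.
  by rewrite natrM -[_ *+ m1]mulr_natr -[_ *+ m2]mulr_natr; ring.
move=> /eqP; rewrite mulf_eq0 expf_eq0 (negPf d0) /= subr_eq0 eqr_nat => /eqP <-.
rewrite cardG => m2E; have -> : m2 = k by nia.
by rewrite mulnC.
Qed.

(** Each of the two eigenvalues contributes [k * d ^ 3]. *)
Lemma MSN_energy_cliques (C : numClosedFieldType) (k : nat) :
  #|G| = (k * d.+1)%N -> MSN_energy C G = 2 * k%:R * d%:R ^+ 3.
Proof.
move=> /(MSN_spectrum_cliques C) E; rewrite /MSN_energy E sum_msetn2.
by rewrite normrN !normrX normr_nat -[_ *+ (k * d)]mulr_natr -[_ *+ k]mulr_natr natrM; ring.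
Qed.

End DisjointCliques.

(** * Additive groups of finite rings: cyclic quotients and centralizers *)

Lemma cyclic_abelian_pq (gT : finGroupType) (G : {group gT}) (p q : nat) :
  prime p -> prime q -> p != q -> abelian G -> #|G| = (p * q)%N -> cyclic G.
Proof.
move=> p_pr q_pr pq abG oG.
have [x Gx ox] : {x | x \in G & #[x]%g = p} by apply: Cauchy; rewrite ?oG ?dvdn_mulr.
have [y Gy oy] : {y | y \in G & #[y]%g = q} by apply: Cauchy; rewrite ?oG ?dvdn_mull.
have oxy : #[x * y]%g = (p * q)%N.
  rewrite orderM ?ox ?oy // ?prime_coprime ?dvdn_prime2 //.
  exact: (centsP abG).
apply/cyclicP; exists (x * y)%g; apply/eqP.
by rewrite eq_sym eqEcard cycle_subG groupM //= -[#|<[_]>%g|]/(#[_]%g) oxy oG.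
Qed.

Section FiniteRing.
Variable R : finPzRingType.
(** Viewing [R] as a [finZmodType] makes it a finite group under addition, so the group product on
    [V] is ring addition. *)
Local Notation V := (R : finZmodType).

Definition centralizer (x : R) : {set R} := [set y | x * y == y * x].

Fact centralizer_group_set x : group_set (centralizer x : {set V}).
Proof.
apply/group_setP; split=> [|y z]; rewrite !inE ?FinRing.zmod1gE ?mulr0 ?mul0r // FinRing.zmodMgE.
by rewrite mulrDl mulrDr => /eqP-> /eqP->.
Qed.
Canonical centralizer_group x := Group (centralizer_group_set x).

Fact ring_center_group_set : group_set (ring_center R : {set V}).
Proof.
apply/group_setP; split=> [|y z]; rewrite !inE ?FinRing.zmod1gE ?FinRing.zmodMgE.
  by apply/forallP=> x; rewrite mulr0 mul0r.
move=> /forallP yC /forallP zC; apply/forallP=> x.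
by rewrite mulrDl mulrDr (eqP (yC x)) (eqP (zC x)).
Qed.
Canonical ring_center_group := Group ring_center_group_set.

Lemma ring_centerP (z : R) : reflect (forall x, z * x = x * z) (z \in ring_center R).
Proof. by rewrite inE; apply: 'forall_eqP. Qed.

Lemma ring_center_sub_centralizer x : ring_center R \subset centralizer x.
Proof. by apply/subsetP=> z /ring_centerP zC; rewrite inE zC. Qed.

Lemma norm_ring_center (A : {set V}) : (A \subset 'N(ring_center_group))%g.
Proof.
apply: subset_trans (subsetT A) _.
exact: sub_abelian_norm (FinRing.zmod_abelian _) (subsetT _).
Qed.

Lemma card_quotient_center (A : {group V}) :
  ring_center R \subset A -> #|A / ring_center_group|%g = (#|A| %/ #|ring_center R|)%N.
Proof. by move=> ZA; rewrite card_quotient ?norm_ring_center // -divgS. Qed.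

(* The additive analogue of: a group with cyclic quotient by its center is
   abelian. *)
Lemma cyclic_quotient_commute (A : {group V}) :
  cyclic (A / ring_center_group)%g -> {in A &, forall x y : R, x * y = y * x}.
Proof.
case/cyclicP=> gb defA.
have [g _ gE] := cosetP gb.
have nZ (x : V) : x \in ('N(ring_center_group))%g.
  by apply: (subsetP (norm_ring_center setT)); rewrite inE.
(* As [g] lifts a generator of the quotient, elements of [A] are central up to multiples of [g], and
   these commute. *)
have dec (x : R) : x \in A -> exists n, exists2 z, z \in ring_center R & x = z + g *+ n.
  move=> Ax; have /cycleP[n] : coset ring_center_group x \in <[gb]>%g.
    by rewrite -defA mem_quotient.
  rewrite gE -morphX ?nZ // => /(rcoset_kercosetP (nZ _) (nZ _)) /rcosetP[z Zz ->].
  by exists n, z.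
move=> x y /dec[m [z /ring_centerP Zz ->]] /dec[n [t /ring_centerP Zt ->]].
rewrite -/(GRing.comm _ _).
have gg : GRing.comm (g *+ m) (g *+ n) by apply/commrMn/commr_sym/commrMn.
apply: commrD; first exact/commr_sym/Zt.
apply/commr_sym/commrD; [exact/commr_sym/Zz | exact/commr_sym].
Qed.

Local Notation Z := (ring_center R).

Lemma centralizer_id x : x \in centralizer x.
Proof. by rewrite inE. Qed.

Lemma centralizerT x : centralizer x = setT -> x \in Z.
Proof. by move=> xT; apply/ring_centerP=> y; apply/eqP; have := in_setT y; rewrite -xT inE. Qed.

Lemma card_center_pq (p q m : nat) :
  prime p -> prime q -> p != q -> #|R| = (p * q * m)%N -> #|Z| != m.
Proof.
move=> p_pr q_pr pq oR; apply/eqP=> oZ.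
have m_gt0 : (0 < m)%N by rewrite -oZ; apply/card_gt0P; exists 0; apply: group1 ring_center_group.
have cycR : cyclic ([set: V] / ring_center_group)%g.
  apply: (@cyclic_abelian_pq _ _ p q) => //.
    exact/quotient_abelian/FinRing.zmod_abelian.
  by rewrite card_quotient_center ?subsetT //= cardsT oR oZ mulnK.
have ZT : Z = setT.
  apply/setP=> x; rewrite in_setT; apply/ring_centerP=> y.
  by apply: (cyclic_quotient_commute _ cycR); rewrite in_setT.
have pq_gt1 : (1 < p * q)%N by rewrite (leq_mul (prime_gt0 p_pr) (prime_gt1 q_pr)).
(* If the center were all of [R], then [m = p * q * m] with [0 < m], against [1 < p * q]. *)
by move/eqP: oR; rewrite -cardsT -ZT oZ -[X in X == _]mul1n eqn_pmul2r // => /eqP; lia.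
Qed.

(** * Rings of order [p ^ 4] with center of order [p ^ 2] *)

Section CardP4.
Variable p : nat.
Hypotheses (p_pr : prime p) (oR : #|R| = (p ^ 4)%N) (oZ : #|Z| = (p ^ 2)%N).

(** By Lagrange the order is a power of [p]. It lies strictly between [p ^ 2] and [p ^ 4]: the
    centralizer contains [Z] and also [x], but is not all of [R]. *)
Lemma card_centralizer x : x \notin Z -> #|centralizer x| = (p ^ 3)%N.
Proof.
move=> xZ; have p_gt1 := prime_gt1 p_pr.
have /dvdn_pfactor : (#|centralizer x| %| p ^ 4)%N.
  by rewrite -oR -cardsT (@cardSg V [set: V]%G (centralizer_group x)) ?subsetT.
case=> // k k4 oC; rewrite oC; congr (p ^ _)%N; apply/eqP.
have : (2 < k)%N.
  rewrite -(ltn_exp2l _ _ p_gt1) -oC -oZ proper_card // properE ring_center_sub_centralizer.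
  by apply: contra xZ => /subsetP/(_ x (centralizer_id x)).
suff : (k < 4)%N by lia.
rewrite -(ltn_exp2l _ _ p_gt1) -oC -oR -cardsT proper_card // properT.
by apply: contra xZ => /eqP/centralizerT.
Qed.

Lemma centralizer_commute x :
  x \notin Z -> {in centralizer x &, forall y z : R, y * z = z * y}.
Proof.
move=> xZ; apply: (@cyclic_quotient_commute (centralizer_group x)); apply: prime_cyclic.
rewrite card_quotient_center ?ring_center_sub_centralizer // card_centralizer // oZ.
by rewrite -expnB ?prime_gt0.
Qed.

Lemma commuting_graph_trans (u v w : commuting_graph R) :
  adj u v -> adj v w -> u != w -> adj u w.
Proof.
rewrite /= /commuting_adj => /andP[_ uv] /andP[_ vw] ->; apply/eqP.
by apply: (@centralizer_commute (val v)); rewrite ?(valP v) // inE // eq_sym.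
Qed.

Lemma deg_commuting_graph (v : commuting_graph R) : deg v = (p ^ 3 - p ^ 2 - 1)%N.
Proof.
have vZ : val v \notin Z := valP v.
rewrite /deg -(card_imset _ val_inj).
have -> : val @: nbr v = (centralizer (val v) :\: Z) :\ val v.
  apply/setP=> y; rewrite in_setD1 in_setD; apply/imsetP/and3P => [[w]|[yv yZ]].
    rewrite inE => /andP[vw cvw] ->.
    by split; [rewrite (inj_eq val_inj) eq_sym | exact: (valP w) | rewrite inE].
  rewrite inE => vy; exists (Sub y yZ) => //.
  by rewrite inE /= /commuting_adj -val_eqE /= eq_sym yv.
have := cardsD1 (val v) (centralizer (val v) :\: Z).
rewrite in_setD vZ centralizer_id cardsD (setIidPr (ring_center_sub_centralizer _)).
by rewrite card_centralizer // oZ; lia.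
Qed.

Lemma card_commuting_graph : #|commuting_graph R| = (p ^ 4 - p ^ 2)%N.
Proof.
rewrite card_sig -oR -oZ -cardsT -(setIidPr (subsetT Z)) -cardsD setTD -cardsE.
by apply: eq_card => x; rewrite !inE.
Qed.

End CardP4.
End FiniteRing.

Theorem theorem4p4 (C : numClosedFieldType) (p q : nat) (R : finPzRingType)
    (p_prime : prime p) (q_prime : prime q)
    (cardR : #|R| = (p ^ 3 * q)%N) (cardZ : #|ring_center R| = (p ^ 2)%N) :
  let a : C := p%:R ^+ 3 - p%:R ^+ 2 - 1 in
  let b : C := p%:R ^+ 2 * q%:R - p%:R ^+ 2 - 1 in
  let na := (p ^ 3 - p ^ 2 - 1)%N in
  let nb := (p ^ 2 * q - p ^ 2 - 1)%N in
  [/\ (p - 1 %| p * q - 1)%N ->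
        MSN_spectrum C (commuting_graph R) =
          msetn ((p * q - 1) * na %/ (p - 1))%N (- a ^+ 2)
          `+` msetn ((p * q - 1) %/ (p - 1))%N (a ^+ 3)
        /\ MSN_energy C (commuting_graph R) =
             2 * (p%:R * q%:R - 1) * a ^+ 3 / (p%:R - 1),
      (q - 1 %| p * q - 1)%N ->
        MSN_spectrum C (commuting_graph R) =
          msetn ((p * q - 1) * nb %/ (q - 1))%N (- b ^+ 2)
          `+` msetn ((p * q - 1) %/ (q - 1))%N (b ^+ 3)
        /\ MSN_energy C (commuting_graph R) =
             2 * (p%:R * q%:R - 1) * b ^+ 3 / (q%:R - 1)
    & forall l1 l2 : nat,
        (p * q - 1 = (p - 1) * l1 + (q - 1) * l2)%N ->
        MSN_spectrum C (commuting_graph R) =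
          msetn (l1 * na)%N (- a ^+ 2) `+` msetn l1 (a ^+ 3)
          `+` msetn (l2 * nb)%N (- b ^+ 2) `+` msetn l2 (b ^+ 3)
        /\ MSN_energy C (commuting_graph R) =
             2 * l1%:R * a ^+ 3 + 2 * l2%:R * b ^+ 3].

Proof.
move=> a b na nb.
have pq : p = q.
  apply/eqP; apply: contra_eqT cardZ => pq.
  by apply: (@card_center_pq _ p q) => //; rewrite cardR; lia.
subst q; have oR : #|R| = (p ^ 4)%N by rewrite cardR; lia.
have p_gt1 := prime_gt1 p_prime.
have -> : b = a by rewrite /b /a; ring.
have -> : nb = na by rewrite /nb /na; lia.
have na_gt1 : (1 < na)%N by rewrite /na; nia.
have naE : na%:R = a by rewrite /na /a !natrB ?natrX //; nia.
(* A clique has [na + 1 = p ^ 3 - p ^ 2] vertices, and [p ^ 4 - p ^ 2 = (p + 1) * (p ^ 3 - p ^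
   2)]. *)
have cardG : #|commuting_graph R| = (p.+1 * na.+1)%N.
  by rewrite (card_commuting_graph _ p) // /na; nia.
have regG := deg_commuting_graph R p p_prime oR cardZ.
have transG := commuting_graph_trans R p p_prime oR cardZ.
have := MSN_spectrum_cliques _ _ na_gt1 regG transG C _ cardG.
have := MSN_energy_cliques _ _ na_gt1 regG transG C _ cardG.
rewrite naE => -> ->.
have ppE : (p * p - 1 = (p - 1) * p.+1)%N by lia.
have p1_gt0 : (0 < p - 1)%N by lia.
have p1_neq0 : p%:R - 1 != 0 :> C by rewrite subr_eq0 pnatr_eq1; lia.
have partE : msetn ((p * p - 1) * na %/ (p - 1))%N (- a ^+ 2)
    `+` msetn ((p * p - 1) %/ (p - 1))%N (a ^+ 3)
  = msetn (p.+1 * na)%N (- a ^+ 2) `+` msetn p.+1 (a ^+ 3).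
  by rewrite ppE -mulnA !mulKn.
have energyE : 2 * p.+1%:R * a ^+ 3
  = 2 * (p%:R * p%:R - 1) * a ^+ 3 / (p%:R - 1) :> C.
  by rewrite -natr1; field.
split=> [_|_|l1 l2]; [by rewrite partE energyE.. |].
(* Cancelling [p - 1] leaves [p + 1 = l1 + l2], so the multiplicities in (c) add up to those
   found. *)
rewrite -mulnDr ppE => /eqP; rewrite eqn_pmul2l // => /eqP ->; split.
  apply/msetP=> z; rewrite !msetE2 !msetnE mulnDl.
  by case: (z == _); case: (z == _); lia.
by rewrite natrD; ring.
Qed.
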